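(* Let $d\ge1$ and let $\mathbb P$ be an arbitrary probability law on $\mathbb R^d$. For all $\mathbf z\in\mathbb R^d$ it holds that $$D_\delta(\mathbf z|\mathbb P)\downarrow D_0(\mathbf z|\mathbb P)\qquad\text{as }\delta\downarrow0,$$ that is, $\delta\mapsto D_\delta(\mathbf z|\mathbb P)$ decreases to $D_0(\mathbf z|\mathbb P)$ as $\delta>0$ decreases to $0$.
   Context: $\|\cdot\|$ is the Euclidean norm and $\langle\cdot,\cdot\rangle$ the Euclidean inner product. For laws $\mathbb P,\mathbb P'$ on $\mathbb R^d$ (no moment assumption) the Wasserstein distance is $d_W(\mathbb P,\mathbb P')=\inf_\Pi\int\|\mathbf x-\mathbf y\|\,\Pi(\mathrm d\mathbf x,\mathrm d\mathbf y)\in[0,\infty]$, over all joint laws $\Pi$ with marginals $\mathbb P,\mathbb P'$. For $\delta>0$ the robustified halfspace depth is $$D_\delta(\mathbf z|\mathbb P)=\inf_{\mathbf u\in\mathbb R^d:\|\mathbf u\|=1}\ \sup_{\mathbb P':d_W(\mathbb P',\mathbb P)\le\delta}\mathbb P'(\{\mathbf x\in\mathbb R^d:\langle\mathbf u,\mathbf x-\mathbf z\rangle\ge0\}),$$ and the classical (Tukey) halfspace depth is $D_0(\mathbf z|\mathbb P)=\inf_{\|\mathbf u\|=1}\mathbb P(\{\mathbf x:\langle\mathbf u,\mathbf x-\mathbf z\rangle\ge0\})$. *)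

(* Defs.v *)
From HB Require Import structures.
From mathcomp Require Import all_boot all_order all_algebra.
From mathcomp Require Import all_classical all_reals all_analysis.

Set Implicit Arguments.
Unset Strict Implicit.
Unset Printing Implicit Defensive.

Import Order.TTheory GRing.Theory Num.Theory.
Import numFieldNormedType.Exports.

Local Open Scope classical_set_scope.
Local Open Scope ring_scope.

(* R^d with its Borel sigma-algebra, generated by the open sets of the library
   topology on row vectors (the Euclidean one, all norms being equivalent). *)
Definition borelRV (R : realType) (d : nat) :=
  g_sigma_algebraType (@open 'rV[R]_d).

Section depth.
Context {R : realType} {d : nat}.

Definition inner (u v : 'rV[R]_d) : R := \sum_(i < d) u ord0 i * v ord0 i.

(* The library norm `|x| on 'rV[R]_d is the maximum norm, hence this one. *)
Definition enorm (x : 'rV[R]_d) : R := Num.sqrt (inner x x).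

Definition coupling (P Q : probability (borelRV R d) R)
    (Pi : probability (borelRV R d * borelRV R d)%type R) : Prop :=
  forall A : set (borelRV R d), measurable A ->
    Pi (fst @^-1` A) = P A /\ Pi (snd @^-1` A) = Q A.

Definition wasserstein (P Q : probability (borelRV R d) R) : \bar R :=
  ereal_inf [set (\int[Pi]_p (enorm ((p.1 : 'rV[R]_d) - p.2))%:E)%E
            | Pi in coupling P Q].

Definition halfspace (u z : 'rV[R]_d) : set (borelRV R d) :=
  [set x : 'rV[R]_d | 0 <= inner u (x - z)].

Definition robust_depth (delta : R) (z : 'rV[R]_d)
    (P : probability (borelRV R d) R) : \bar R :=
  ereal_inf
    [set ereal_sup [set P' (halfspace u z)
                   | P' in [set P' : probability (borelRV R d) R |
                            (wasserstein P' P <= delta%:E)%E]]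
    | u in [set u : 'rV[R]_d | enorm u = 1]].

Definition tukey_depth (z : 'rV[R]_d)
    (P : probability (borelRV R d) R) : \bar R :=
  ereal_inf [set P (halfspace u z) | u in [set u : 'rV[R]_d | enorm u = 1]].

End depth.

(* Main.v *)
(** The diagonal coupling shows that [P] lies in its own Wasserstein balls, so
    the robust depth dominates the Tukey depth. Conversely, fix a unit vector
    [u] and a law [P'] coupled to [P] at transport cost at most [c]. By
    Cauchy-Schwarz and Markov, the mass that [P'] gives to the halfspace is at
    most the mass that [P] gives to the halfspace shifted outwards by [eta],
    plus [c / eta]. Continuity from above of [P] as [eta] goes to [0], followed
    by [c] going to [0] for fixed [eta], bounds the limit of the robust depths
    by [P (halfspace u z)] for each [u], and no uniformity in [u] is needed. *)

Require Import Defs.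
From HB Require Import structures.
From mathcomp Require Import all_boot all_order all_algebra.
From mathcomp Require Import all_classical all_reals all_analysis.
From mathcomp Require Import measurable_realfun ring lra.

Import Order.TTheory GRing.Theory Num.Theory.
Import numFieldNormedType.Exports.

Local Open Scope classical_set_scope.
Local Open Scope ring_scope.

Section inner_product.
Context {R : realType} {d : nat}.
Implicit Types u v w : 'rV[R]_d.

Lemma innerBr u v w : inner u (v - w) = inner u v - inner u w.
Proof.
rewrite /inner -sumrB; apply: eq_bigr => i _.
by rewrite !mxE mulrBr.
Qed.

Lemma inner_le_enorm u w : enorm u = 1 -> inner u w <= enorm w.
Proof.
move=> u1; have uu : inner u u = 1.
  have uu0 : 0 <= inner u u.
    by rewrite /inner sumr_ge0// => i _; rewrite -expr2 sqr_ge0.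
  by rewrite -(sqr_sqrtr uu0) -[Num.sqrt _]/(enorm u) u1 expr1n.
move tE : (inner u w) => t.
(* |w - t u|^2 = |w|^2 - t^2 is nonnegative *)
have t2w : t ^+ 2 <= inner w w.
  rewrite -subr_ge0; have -> : inner w w - t ^+ 2 =
      \sum_(i < d) (w ord0 i - t * u ord0 i) ^+ 2.
    transitivity (inner w w - 2 * t * inner u w + t ^+ 2 * inner u u).
      by rewrite uu tE; ring.
    rewrite /inner !mulr_sumr -sumrB -big_split/=.
    by apply: eq_bigr => i _; ring.
  by rewrite sumr_ge0// => i _; rewrite sqr_ge0.
by rewrite (le_trans (ler_norm t))// -sqrtr_sqr ler_wsqrtr.
Qed.

End inner_product.

Section measurability.
Context {R : realType} {d : nat}.

(** Open intervals generate the Borel sets of the line, and their preimages under a continuous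
    coordinate are open, hence among the generators of [borelRV R d]. *)
Lemma measurable_coord (i : 'I_d) :
  measurable_fun setT (fun x : borelRV R d => (x : 'rV[R]_d) ord0 i).
Proof.
apply: (measurability _ (RGenOpens.measurableE R)).
move=> _ [_ [a [b ->]] <-]; rewrite setTI; apply: sub_sigma_algebra.
apply: (@open_comp 'rV[R]_d R (fun M => M ord0 i)); last exact: itv_open.
by move=> x _; exact: coord_continuous.
Qed.

Context d' (T : measurableType d').

Lemma measurable_inner (f g : T -> borelRV R d) :
  measurable_fun setT f -> measurable_fun setT g ->
  measurable_fun setT (fun t => inner (f t : 'rV[R]_d) (g t)).
Proof.
move=> mf mg; apply: measurable_sum => i.
by apply: measurable_funM; apply: (measurableT_comp (measurable_coord i)).
Qed.

(** Argued coordinate by coordinate: couplings live on the product sigma-algebra, which is generated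
    by the two projections and not by open sets of pairs, so continuity of the distance does not
    apply directly. *)
Lemma measurable_enormB (f g : T -> borelRV R d) :
  measurable_fun setT f -> measurable_fun setT g ->
  measurable_fun setT (fun t => enorm ((f t : 'rV[R]_d) - g t)).
Proof.
move=> mf mg; rewrite /enorm /inner.
apply: (measurableT_comp
  (continuous_measurable_fun (@sqrt_continuous R))).
apply: measurable_sum => i; under eq_fun do rewrite !mxE.
by apply: measurable_funM; apply: measurable_funB;
  exact: (measurableT_comp (measurable_coord i)).
Qed.

End measurability.

Section enlarged_halfspace.
Context {R : realType} {d : nat}.
Implicit Types u z : 'rV[R]_d.

(** For a unit vector [u] and [eta >= 0], this is the closed [eta]-neighbourhood of
    [halfspace u z]. *)
Definition enlarged_halfspace u z (eta : R) : set (borelRV R d) :=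
  [set x : 'rV[R]_d | - eta <= inner u (x - z)].

Lemma enlarged_halfspace0 u z : enlarged_halfspace u z 0 = halfspace u z.
Proof. by rewrite /enlarged_halfspace oppr0. Qed.

Lemma measurable_enlarged_halfspace u z eta :
  measurable (enlarged_halfspace u z eta).
Proof.
have mf : measurable_fun setT
    (fun x : borelRV R d => inner u (x : 'rV[R]_d) - inner u z).
  apply: measurable_funB => //.
  by apply: measurable_inner => //; exact: measurable_id.
have := mf measurableT _ (measurable_itv `[- eta, +oo[); rewrite setTI.
congr measurable; apply/seteqP; split=> x /=;
  by rewrite /enlarged_halfspace /= in_itv/= andbT innerBr.
Qed.

Lemma measurable_halfspace u z : measurable (halfspace u z).
Proof.
by rewrite -enlarged_halfspace0; exact: measurable_enlarged_halfspace.
Qed.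

Lemma enlarged_halfspace_cvg (P : probability (borelRV R d) R) u z :
  P (enlarged_halfspace u z n.+1%:R^-1) @[n --> \oo] --> P (halfspace u z).
Proof.
(* The intersection adds no boundary points because the halfspace is closed: its weak inequality
   survives the limit. *)
have -> : halfspace u z = \bigcap_n enlarged_halfspace u z n.+1%:R^-1.
  apply/seteqP; split=> [x /= zx n _|x hx].
    by rewrite /enlarged_halfspace/= (le_trans _ zx)// oppr_le0 invr_ge0.
  rewrite /halfspace/= -oppr_le0; apply/ler_addgt0Pr => e e0.
  have [n ne] : exists n : nat, n.+1%:R^-1 < e.
    near \oo => n; exists n; near: n.
    exact: near_infty_natSinv_lt (PosNum e0).
  by rewrite add0r lerNl (le_trans _ (hx n I))// lerN2 ltW.
apply: nonincreasing_cvg_mu.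
- by rewrite (le_lt_trans (probability_le1 _ _))//= ?ltry//;
    exact: measurable_enlarged_halfspace.
- by move=> n; exact: measurable_enlarged_halfspace.
- by apply: bigcapT_measurable => n; exact: measurable_enlarged_halfspace.
- move=> m n mn; apply/subsetPset => x; rewrite /enlarged_halfspace/=.
  by apply: le_trans; rewrite lerN2 lef_pV2 ?posrE// ler_nat ltnS.
Unshelve. all: by end_near. Qed.

Lemma enlarged_halfspace_le (P : probability (borelRV R d) R) u z (e : R) :
  0 < e -> exists2 eta : R, 0 < eta &
    (P (enlarged_halfspace u z eta) <= P (halfspace u z) + e%:E)%E.
Proof.
move=> e0; apply: contrapT => /forall2NP H.
have Pfin : P (halfspace u z) \is a fin_num.
  by apply: fin_num_measure; exact: measurable_halfspace.
have Pcvg := enlarged_halfspace_cvg P u z.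
(* If every [eta] failed, all terms of the convergent sequence, hence its limit, would be at least
   [P (halfspace u z) + e], which is absurd for a finite value. *)
suff : (P (halfspace u z) + e%:E <= P (halfspace u z))%E.
  by rewrite leNgt lteDl// lte_fin e0.
rewrite -[leRHS](cvg_lim _ Pcvg)//; apply: lime_ge.
  by apply/cvg_ex; eexists; exact: Pcvg.
apply: nearW => n; case: (H n.+1%:R^-1) => [|/negP]; first by rewrite invr_gt0.
by rewrite -ltNge => /ltW.
Qed.

End enlarged_halfspace.

Section wasserstein.
Context {R : realType} {d : nat}.
Implicit Types P Q : probability (borelRV R d) R.

Lemma measurable_diag : measurable_fun setT (fun x : borelRV R d => (x, x)).
Proof. by apply: measurable_fun_pair; exact: measurable_id. Qed.

Lemma measurable_cost :
  measurable_fun setT (fun p : borelRV R d * borelRV R d =>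
    (enorm ((p.1 : 'rV[R]_d) - p.2))%:E).
Proof.
apply/measurable_EFinP.
exact: (measurable_enormB _ _ fst snd measurable_fst measurable_snd).
Qed.

Lemma wasserstein_refl_le0 P : (wasserstein P P <= 0)%E.
Proof.
pose f := mfun_Sub (mem_set measurable_diag).
pose Pi := distribution P f.
apply: ereal_inf_lbound; exists Pi => //.
(* Change of variables along the diagonal turns the cost into the integral of [enorm (x - x)]. *)
rewrite /Pi /distribution ge0_integral_pushforward//=.
- rewrite integral0_eq// => x _ /=.
  by rewrite subrr /enorm /inner big1 ?sqrtr0// => i _; rewrite mxE mul0r.
- exact: measurable_diag.
- exact: measurable_cost.
- by move=> x _; rewrite lee_fin sqrtr_ge0.
Qed.

Lemma coupling_halfspace_le P Q Pi u z (eta c : R) :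
  enorm u = 1 -> 0 < eta -> coupling P Q Pi ->
  (\int[Pi]_p (enorm ((p.1 : 'rV[R]_d) - p.2))%:E <= c%:E)%E ->
  (P (halfspace u z) <= Q (enlarged_halfspace u z eta) + (c / eta)%:E)%E.
Proof.
move=> u1 eta0 PQ intc.
have [<- _] := PQ _ (measurable_halfspace u z).
have [_ <-] := PQ _ (measurable_enlarged_halfspace u z eta).
pose g (p : borelRV R d * borelRV R d) := (enorm ((p.1 : 'rV[R]_d) - p.2))%:E.
pose far := [set p | (eta%:E <= `|g p|)%E].
have mfar : measurable far.
  rewrite -[far]setTI; apply: emeasurable_fun_c_infty => //.
  by apply: measurableT_comp => //; exact: measurable_cost.
have m1 : measurable
    (fst @^-1` halfspace u z : set (borelRV R d * borelRV R d)).
  rewrite -[X in measurable X]setTI; apply: measurable_fst => //.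
  exact: measurable_halfspace.
have m2 : measurable
    (snd @^-1` enlarged_halfspace u z eta : set (borelRV R d * borelRV R d)).
  rewrite -[X in measurable X]setTI; apply: measurable_snd => //.
  exact: measurable_enlarged_halfspace.
(* Markov's inequality for the transport distance; the absolute value in [far] matches the form in
   which it is applied. *)
have Pifar : (Pi far <= (c / eta)%:E)%E.
  rewrite EFinM lee_pdivlMr// muleC; apply: le_trans intc.
  have := @le_integral_comp_abse _ _ _ Pi setT measurableT g eta id.
  rewrite setTI => /(_ (@measurable_id _ _ _)) H.
  apply: (le_trans (H _ _ _ _)) => //; first exact: measurable_cost.
  rewrite le_eqVlt; apply/orP; left; apply/eqP; apply: eq_integral => p _.
  by rewrite gee0_abs// lee_fin sqrtr_ge0.
(* A point of the halfspace moved by less than [eta] loses less than [eta] in the direction [u], so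
   it ends in the enlarged halfspace; all other pairs are in [far]. *)
apply: (@le_trans _ _ (Pi (snd @^-1` enlarged_halfspace u z eta `|` far))).
  apply: le_measure; rewrite ?inE//; first exact: measurableU.
  move=> [x y] /=; rewrite /halfspace /enlarged_halfspace /far/= => zx.
  rewrite lee_fin ger0_norm ?sqrtr_ge0//.
  have [|xy] := leP eta (enorm (x - y)); first by right.
  left; have := inner_le_enorm _ ((x : 'rV[R]_d) - y) u1.
  by move: zx xy; rewrite !innerBr; lra.
apply: (le_trans (measureU2 _ _ _)) => //.
exact: leeD2l.
Qed.

End wasserstein.

Section robust_depth.
Context {R : realType} {d : nat}.
Variables (P : probability (borelRV R d) R) (z : 'rV[R]_d).

(** A larger ball admits more laws, so the supremum grows for each [u]. *)
Lemma robust_depth_le (delta1 delta2 : R) : delta1 <= delta2 ->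
  (robust_depth delta1 z P <= robust_depth delta2 z P)%E.
Proof.
move=> d12; apply: le_ereal_inf_tmp => _ [u u1 <-].
apply: ge_ereal_inf; eexists; first by exists u.
apply: le_ereal_sup => _ [Q PQ <-]; exists Q => //=.
by rewrite (le_trans PQ)// lee_fin.
Qed.

Lemma tukey_depth_le_robust (delta : R) : 0 <= delta ->
  (tukey_depth z P <= robust_depth delta z P)%E.
Proof.
move=> delta0; apply: le_ereal_inf_tmp => _ [u u1 <-].
apply: ge_ereal_inf; exists (P (halfspace u z)); first by exists u.
apply: ereal_sup_ubound; exists P => //=.
by rewrite (le_trans (wasserstein_refl_le0 P))// lee_fin.
Qed.

Lemma robust_depth_le_halfspace (u : 'rV[R]_d) (e : R) :
  enorm u = 1 -> 0 < e -> exists2 delta : R, 0 < delta &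
    (robust_depth delta z P <= P (halfspace u z) + e%:E)%E.
Proof.
move=> u1 e0; have e20 : 0 < e / 2 by rewrite divr_gt0.
have [eta eta0 Peta] := enlarged_halfspace_le P u z (e / 2) e20.
(* Half of [e] pays for the enlargement by [eta]; this choice makes the Markov term
   [2 * delta / eta] equal to the other half. *)
pose delta := eta * e / 4.
have delta0 : 0 < delta by rewrite divr_gt0// mulr_gt0.
exists delta => //; apply: ge_ereal_inf; eexists; first by exists u.
apply: ge_ereal_sup => _ [Q PQ <-].
(* The infimum defining the distance need not be attained: spend [2 * delta]. *)
have : (wasserstein Q P < (2 * delta)%:E)%E.
  by rewrite (le_lt_trans PQ)// lte_fin; lra.
move=> /ereal_inf_lt[_ [Pi QP <-]] /ltW Pidelta.
apply: (le_trans (coupling_halfspace_le _ _ _ _ _ _ _ u1 eta0 QP Pidelta)).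
have -> : 2 * delta / eta = e / 2 by rewrite /delta; field; rewrite gt_eqF.
by rewrite [e in leRHS]splitr EFinD addeA leeD2r.
Qed.

(** Identifies the limit: by monotonicity in [delta], the right limit at [0] is the infimum over
    positive radii. *)
Lemma ereal_inf_robust_depth :
  ereal_inf [set robust_depth delta z P | delta in `]0%R, +oo[] =
  tukey_depth z P.
Proof.
apply/eqP; rewrite eq_le; apply/andP; split.
  apply: le_ereal_inf_tmp => _ [u u1 <-].
  apply/lee_addgt0Pr => e e0.
  have [delta delta0 le_depth] := robust_depth_le_halfspace u e u1 e0.
  apply: ge_ereal_inf; eexists; last exact: le_depth.
  by exists delta => //=; rewrite in_itv/= andbT.
apply: le_ereal_inf_tmp => _ [delta + <-].
by rewrite /= in_itv/= andbT => /ltW; exact: tukey_depth_le_robust.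
Qed.

End robust_depth.

Theorem proposition4 (R : realType) (d : nat) (hd : (1 <= d)%N)
    (P : probability (borelRV R d) R) (z : 'rV[R]_d) :
  (forall delta1 delta2 : R, 0 < delta1 -> delta1 <= delta2 ->
     (robust_depth delta1 z P <= robust_depth delta2 z P)%E) /\
  robust_depth delta z P @[delta --> 0^'+] --> tukey_depth z P.
Proof.
split=> [delta1 delta2 _|]; first exact: robust_depth_le.
rewrite -ereal_inf_robust_depth; apply: nondecreasing_at_right_cvge => //.
by move=> delta1 delta2 _ _; exact: robust_depth_le.
Qed.
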